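(* Let $T$ be a polynomial action, being the action of an $E$-valued $\mathcal P$-polynomial process $X$. Assume that $T$ is locally finite. Then $$ \sum_{n=0}^\infty \frac{h^n}{n!} \mathcal G^np(x) = T_hp(x)$$ for any $p\in\mathcal P$, $x\in E$, $h\geq 0$. Moreover, the extension as a power series converges for any $h\in\mathbb F$ and defines in this way an $\mathbb F$-parametrised group of operators on $\mathcal P$.
   Context: $\mathbb F$ is $\mathbb R$ or $\mathbb C$, $\mathbb N=\{0,1,2,\dots\}$, $\mathbb R_+=[0,\infty)$. $(\Omega,\mathfrak A,(\mathcal F_t)_{t\ge 0},P)$ is a filtered probability space and $E$ is a non-empty set. Polynomials: $\mathcal P$ is a vector space of functions $E\to\mathbb F$ containing all constant functions, together with a degree function $\deg:\mathcal P\to\mathbb N$ such that $\deg(p+q)\le\max\{\deg(p),\deg(q)\}$, $\deg(\lambda p)=\deg(p)$ for $p,q\in\mathcal P$, $\lambda\in\mathbb F\setminus\{0\}$, and $\deg(p)=0$ iff $p$ is constant. Polynomial action: a family $T=(T_h)_{h\ge0}$ of linear operators on $\mathcal P$ with $\deg(T_hp)\le\deg(p)$, $T_0p=p$, $T_hT_k=T_{h+k}$ for $h,k\ge0$, and $h\mapsto (T_hp)(x)$ right-continuous for all $p\in\mathcal P$, $x\in E$. Its generator $\mathcal G$ has domain $\mathcal D$ consisting of all $p\in\mathcal P$ for which there is $q\in\mathcal P$ with $\lim_{h\searrow0}\frac{T_hp(x)-p(x)}{h}=q(x)$ for all $x\in E$, and then $\mathcal Gp:=q$. $T$ is locally finite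 if for any $p\in\mathcal P$ there is $d\in\mathbb N$ such that for any $h>0$ the family $\{T_h^kp:k=0,\dots,d\}$ is linearly dependent ($T_h^k$ is the $k$-fold composition); in this case $\mathcal D=\mathcal P$, so powers $\mathcal G^n$ (compositions) are defined on $\mathcal P$. Polynomial process: a function $X:\Omega\times\mathbb R_+\to E$ is an $E$-valued $\mathcal P$-polynomial process with action $T$ if for all $p\in\mathcal P$: $\mathbb E[|p(X_t)|]<\infty$ for $t\ge0$; $\mathbb E[p(X_{t+h})|\mathcal F_t]=T_hp(X_t)$ for $t,h\ge0$; $t\mapsto p(X_t)$ has càdlàg paths; $p(X_t)$ is $\mathcal F_t$-measurable for $t\ge0$. An $\mathbb F$-parametrised group of operators is a family $(T_h)_{h\in\mathbb F}$ of linear operators with $T_0=I$ and $T_hT_k=T_{h+k}$ for all $h,k\in\mathbb F$. *)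

(* Defs.v *)
From HB Require Import structures.
From mathcomp Require Export all_boot all_order all_algebra.
From mathcomp Require Export complex.
From mathcomp Require Export all_classical all_reals all_analysis.

Set Implicit Arguments.
Unset Strict Implicit.
Unset Printing Implicit Defensive.

Import Order.TTheory GRing.Theory Num.Theory.
Import numFieldNormedType.Exports.

Local Open Scope classical_set_scope.
Local Open Scope ring_scope.

(* The scalar field F is either R or C = R[i]. *)
Inductive scalar_kind := RealScalars | ComplexScalars.

Definition scalars (R : realType) (k : scalar_kind) : numFieldType :=
  match k with RealScalars => R | ComplexScalars => R[i] end.

Definition of_real (R : realType) (k : scalar_kind) : R -> scalars R k :=
  match k return R -> scalars R k with
  | RealScalars => fun x => x
  | ComplexScalars => fun x => x%:C%C
  end.

(* The modulus as an element of R: on R[i] the library's `|z| lives in R[i]. *)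
Definition modulus (R : realType) (k : scalar_kind) : scalars R k -> R :=
  match k return scalars R k -> R with
  | RealScalars => fun x : R => `|x|
  | ComplexScalars => fun z : R[i] => complex.Re `|z|
  end.

Definition scalar_integral (R : realType) (k : scalar_kind)
    (d : measure_display) (Omega : measurableType d)
    (Pr : probability Omega R) (A : set Omega) :
    (Omega -> scalars R k) -> scalars R k :=
  match k return (Omega -> scalars R k) -> scalars R k with
  | RealScalars => fun Y : Omega -> R => \int[Pr]_(w in A) Y w
  | ComplexScalars => fun Y : Omega -> R[i] =>
      ((\int[Pr]_(w in A) complex.Re (Y w))
        +i* (\int[Pr]_(w in A) complex.Im (Y w)))%C
  end.

Section Polynomials.
Context {R : realType} {k : scalar_kind} {E : Type}.
Local Notation F := (scalars R k).

(* A linear subspace of the space of all functions E -> F, as a type. *)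
Definition polynomial (Pol : submodClosed (E -> F^o)) : Type :=
  {p : E -> F^o | p \in Pol}.

HB.instance Definition _ (Pol : submodClosed (E -> F^o)) :=
  SubType.copy (polynomial Pol) {p : E -> F^o | p \in Pol}.
HB.instance Definition _ (Pol : submodClosed (E -> F^o)) :=
  [Choice of polynomial Pol by <:].
HB.instance Definition _ (Pol : submodClosed (E -> F^o)) :=
  [SubChoice_isSubLmodule of polynomial Pol by <:].

Definition peval (Pol : submodClosed (E -> F^o)) (p : polynomial Pol) :
  E -> F := val p.

Definition contains_constants (Pol : submodClosed (E -> F^o)) : Prop :=
  forall c : F, (cst c : E -> F^o) \in Pol.

Variable Pol : submodClosed (E -> F^o).
Local Notation V := (polynomial Pol).

Record is_degree (deg : V -> nat) : Prop := IsDegree {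
  degD : forall p q : V, (deg (p + q)%R <= maxn (deg p) (deg q))%N;
  degZ : forall (a : F) (p : V), a != 0 -> deg (a *: p) = deg p;
  deg0 : forall p : V, deg p = 0%N <-> exists c : F, forall x, peval p x = c }.

(* Only the operators T h with 0 <= h are relevant. *)
Record is_polynomial_action (deg : V -> nat) (T : R -> {linear V -> V}) :
    Prop := IsPolynomialAction {
  action_deg : forall (h : R) (p : V), 0 <= h -> (deg (T h p) <= deg p)%N;
  action0 : forall p : V, T 0 p = p;
  actionD : forall (h h' : R) (p : V), 0 <= h -> 0 <= h' ->
    T h (T h' p) = T (h + h') p;
  action_right_continuous : forall (p : V) (x : E) (h : R), 0 <= h ->
    peval (T s p) x @[s --> h^'+] --> peval (T h p) x }.

Definition is_derivative_at0 (T : R -> {linear V -> V}) (p q : V) : Prop :=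
  forall x : E,
    (peval (T h p) x - peval p x) / of_real k h @[h --> (0 : R)^'+]
      --> peval q x.

Definition generator_domain (T : R -> {linear V -> V}) : set V :=
  [set p | exists q : V, is_derivative_at0 T p q].

(* Limits being unique, [generator T p] is the only q with
   [is_derivative_at0 T p q] when p is in the domain; it is the junk value 0
   outside the domain. *)
Definition generator (T : R -> {linear V -> V}) (p : V) : V :=
  xget 0 [set q : V | is_derivative_at0 T p q].

Definition linearly_dependent (n : nat) (v : 'I_n -> V) : Prop :=
  exists2 c : 'I_n -> F, (exists i, c i != 0) & \sum_i c i *: v i = 0.

Definition locally_finite (T : R -> {linear V -> V}) : Prop :=
  forall p : V, exists d : nat, forall h : R, 0 < h ->
    linearly_dependent (fun j : 'I_d.+1 => iter j (T h) p).

Definition is_operator_group (S : F -> {linear V -> V}) : Prop :=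
  (forall p : V, S 0 p = p) /\
  (forall (h h' : F) (p : V), S h (S h' p) = S (h + h') p).

End Polynomials.

Section Processes.
Context {R : realType} {k : scalar_kind} {d : measure_display}
  {Omega : measurableType d}.
Local Notation F := (scalars R k).

Record is_filtration (Filt : R -> set (set Omega)) : Prop := IsFiltration {
  filtration_sigma_algebra : forall t, 0 <= t -> sigma_algebra setT (Filt t);
  filtration_measurable : forall t, 0 <= t -> Filt t `<=` measurable;
  filtration_mono : forall s t, 0 <= s -> s <= t -> Filt s `<=` Filt t }.

(* Measurability with respect to a sub-sigma-algebra G and the Borel
   sigma-algebra of F. *)
Definition measurable_wrt (G : set (set Omega)) (Y : Omega -> F) : Prop :=
  forall B : set F, <<s [set U : set F | open U] >> B -> G (Y @^-1` B).

Definition has_finite_expectation (Pr : probability Omega R)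
    (Y : Omega -> F) : Prop :=
  ('E_Pr[(fun w => modulus (Y w))] < +oo)%E.

(* Z is a version of the conditional expectation E[Y | G]. *)
Record is_cond_expectation (Pr : probability Omega R) (G : set (set Omega))
    (Y Z : Omega -> F) : Prop := IsCondExpectation {
  cond_expectation_measurable : measurable_wrt G Z;
  cond_expectation_finite : has_finite_expectation Pr Z;
  cond_expectation_integral : forall A, G A ->
    scalar_integral Pr A Z = scalar_integral Pr A Y }.

Definition cadlag (f : R -> F) : Prop :=
  (forall t, 0 <= t -> f s @[s --> t^'+] --> f t) /\
  (forall t, 0 < t -> exists l : F, f s @[s --> t^'-] --> l).

(* [X w t] is only relevant for 0 <= t. *)
Record is_polynomial_process (E : Type) (Pol : submodClosed (E -> F^o))
    (T : R -> {linear polynomial Pol -> polynomial Pol})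
    (Pr : probability Omega R) (Filt : R -> set (set Omega))
    (X : Omega -> R -> E) : Prop := IsPolynomialProcess {
  process_integrable : forall (p : polynomial Pol) (t : R), 0 <= t ->
    has_finite_expectation Pr (fun w => peval p (X w t));
  process_cond_expectation : forall (p : polynomial Pol) (t h : R),
    0 <= t -> 0 <= h ->
    is_cond_expectation Pr (Filt t)
      (fun w => peval p (X w (t + h)))
      (fun w => peval (T h p) (X w t));
  process_cadlag : forall (p : polynomial Pol) (w : Omega),
    cadlag (fun t => peval p (X w t));
  process_adapted : forall (p : polynomial Pol) (t : R), 0 <= t ->
    measurable_wrt (Filt t) (fun w => peval p (X w t)) }.

End Processes.

(* Main.v *)
Require Import Defs.
From HB Require Import structures.
From mathcomp Require Import ring lra.

(* Local finiteness, with its bound d independent of h, bounds by d the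
   size of the nonzero minors of the orbit of p along dyadic times: a maximal
   nonvanishing minor yields functions e_j and points y_j with
   e_i(y_j) = delta_ij such that q = sum_j q(y_j) e_j for every q = T_h p with
   h dyadic, hence, by right-continuity, for every h >= 0.  On the span of the
   e_j the action is a matrix semigroup right-continuous at 0.  Such a semigroup
   is exp(h G): Riemann sums of the semigroup give A_h = 1 + h G + O(h^2), and
   so does exp(h G), so A_h = (A_(h/m))^m and exp(h G) = exp(h G / m)^m differ
   by O(1/m). *)

Set Implicit Arguments.
Unset Strict Implicit.
Unset Printing Implicit Defensive.

Import Order.TTheory GRing.Theory Num.Theory.
Import numFieldNormedType.Exports.
Local Open Scope classical_set_scope.
Local Open Scope ring_scope.

(** For one step h, a dependence among the T_h^j p confines only the orbit at multiples of h, to a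
    space that may change with h. Dyadic times get around this: finitely many of them are multiples
    of a single step 2^-l, so they share one space of dimension at most d, and d is the same for
    every l. Minors test this bounded rank on finite submatrices only, and the points y_j of a
    maximal one serve as coordinate functionals, which turn pointwise right-continuity of the action
    into right-continuity of matrix entries. Differentiability of the matrix semigroup at 0 has to
    be won from right-continuity there. The resulting span depends on p, so the group is put
    together by uniqueness of limits rather than from one global matrix. *)

(** * Real-valued modulus, convergence and completeness over R and C *)

Section Scalars.
Variables (R : realType) (k : scalar_kind).
Local Notation F := (scalars R k).

Lemma of_real_is_zmod_morphism : zmod_morphism (@of_real R k).
Proof. by case: k => x y //=; exact: rmorphB. Qed.
HB.instance Definition _ :=
  GRing.isZmodMorphism.Build R F (@of_real R k) of_real_is_zmod_morphism.
Lemma of_real_is_monoid_morphism : monoid_morphism (@of_real R k).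
Proof.
case: k; first by [].
by split=> [|x y]; [exact: rmorph1|exact: rmorphM].
Qed.
HB.instance Definition _ :=
  GRing.isMonoidMorphism.Build R F (@of_real R k) of_real_is_monoid_morphism.

Lemma of_real_modulus (z : F) : of_real k (modulus z) = `|z|.
Proof. by case: k z => z //=; rewrite normc_def. Qed.

Lemma ler_of_real (x y : R) : (of_real k x <= of_real k y) = (x <= y).
Proof. by case: k => //=; exact: lecR. Qed.

Lemma ltr_of_real (x y : R) : (of_real k x < of_real k y) = (x < y).
Proof. by case: k => //=; exact: ltcR. Qed.

Lemma of_real_inj : injective (@of_real R k).
Proof. exact: fmorph_inj. Qed.

Lemma modulus_ge0 (z : F) : 0 <= modulus z.
Proof. by rewrite -ler_of_real of_real_modulus rmorph0. Qed.

Lemma modulus0 : modulus (0 : F) = 0.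
Proof. by apply: of_real_inj; rewrite of_real_modulus normr0 rmorph0. Qed.

Lemma modulusM (x y : F) : modulus (x * y) = modulus x * modulus y.
Proof. by apply: of_real_inj; rewrite rmorphM /= !of_real_modulus normrM. Qed.

Lemma modulusN (x : F) : modulus (- x) = modulus x.
Proof. by apply: of_real_inj; rewrite !of_real_modulus normrN. Qed.

Lemma modulusV (x : F) : modulus x^-1 = (modulus x)^-1.
Proof. by apply: of_real_inj; rewrite fmorphV /= !of_real_modulus normfV. Qed.

Lemma modulusX (x : F) n : modulus (x ^+ n) = modulus x ^+ n.
Proof. by apply: of_real_inj; rewrite rmorphXn /= !of_real_modulus normrX. Qed.

Lemma modulus_nat n : modulus (n%:R : F) = n%:R.
Proof.
by apply: of_real_inj; rewrite !of_real_modulus normr_nat rmorph_nat.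
Qed.

Lemma modulus_of_real (x : R) : 0 <= x -> modulus (of_real k x) = x.
Proof.
move=> x0; apply: of_real_inj; rewrite of_real_modulus ger0_norm //.
by rewrite -(rmorph0 (@of_real R k)) ler_of_real.
Qed.

Lemma ler_modulusD (x y : F) : modulus (x + y) <= modulus x + modulus y.
Proof. by rewrite -ler_of_real rmorphD /= !of_real_modulus ler_normD. Qed.

(** Keeps the tolerance real even over R[i], where [cvgrPdist_lt] takes it in the field itself, so
    that both scalar fields share one proof. *)
Lemma cvg_modulusP (I : Type) (G : set_system I) {FG : Filter G}
  (f : I -> F) (l : F) :
  f @ G --> l <->
  forall e : R, 0 < e -> \forall t \near G, modulus (f t - l) < e.
Proof.
split=> [/cvgrPdist_lt h e e0|h].
- have := h (of_real k e); rewrite -{1}(rmorph0 (@of_real R k)) ltr_of_real => /(_ e0).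
  apply: filterS => t.
  by rewrite distrC -of_real_modulus ltr_of_real.
- apply/cvgrPdist_lt => e e0.
  have ee : e = (of_real k (modulus e)) by rewrite of_real_modulus gtr0_norm.
  have /h : 0 < modulus e.
    by rewrite -ltr_of_real rmorph0 -ee.
  apply: filterS => t ht.
  by rewrite distrC ee -of_real_modulus ltr_of_real.
Qed.

(** Over the complex numbers, |Re z| and |Im z| are at most the modulus, so both parts are Cauchy;
    the modulus is at most |Re z| + |Im z|, so their limits combine. *)
Lemma scalars_complete (u : nat -> F) :
  (forall e : R, 0 < e -> exists N, forall m n, (N <= m)%N -> (N <= n)%N ->
     modulus (u m - u n) < e) -> exists l : F, u n @[n --> \oo] --> l.
Proof.
have real (v : nat -> R) :
  (forall e : R, 0 < e -> exists N, forall m n, (N <= m)%N -> (N <= n)%N ->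
     `|v m - v n| < e) -> exists l : R, v n @[n --> \oo] --> l.
  move=> hv; exists (lim (v n @[n --> \oo])).
  apply/cauchy_cvgP/cauchy_exP => e e0.
  have [N hN] := hv e e0; exists (v N), N => // n /= Nn.
  by rewrite /ball /=; apply: hN.
have cvgu := @cvg_modulusP nat \oo _ u.
move: u cvgu; case: k => u cvgu hu; first exact: real hu.
have normC (z : scalars R ComplexScalars) : modulus z =
    Num.sqrt (complex.Re z ^+ 2 + complex.Im z ^+ 2).
  by rewrite /modulus normc_def.
have [|a /cvgrPdist_lt ha] := real (fun n => complex.Re (u n)).
  move=> e /hu[N hN]; exists N => m n Nm Nn.
  apply: le_lt_trans (hN m n Nm Nn).
  by rewrite -raddfB normC -sqrtr_sqr ler_wsqrtr // lerDl sqr_ge0.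
have [|b /cvgrPdist_lt hb] := real (fun n => complex.Im (u n)).
  move=> e /hu[N hN]; exists N => m n Nm Nn.
  apply: le_lt_trans (hN m n Nm Nn).
  by rewrite -raddfB normC -sqrtr_sqr ler_wsqrtr // lerDr sqr_ge0.
exists (a +i* b)%C; apply/cvgu => e e0.
have e20 : 0 < e / 2 by rewrite divr_gt0.
near=> n.
have an : `|a - complex.Re (u n)| < e / 2 by near: n; exact: ha.
have bn : `|b - complex.Im (u n)| < e / 2 by near: n; exact: hb.
rewrite normC !raddfB /=; move: an bn.
rewrite distrC => an; rewrite distrC => bn.
move: (complex.Re _ - a) (complex.Im _ - b) an bn => x y an bn.
have xy0 : 0 <= `|x| + `|y| by rewrite addr_ge0.
apply: (@le_lt_trans _ _ (`|x| + `|y|)); last by rewrite (splitr e) ltrD.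
rewrite -[leRHS](ger0_norm xy0) -sqrtr_sqr ler_wsqrtr // sqrrD !real_normK ?num_real //.
by rewrite addrAC lerDl mulrn_wge0 // mulr_ge0.
Unshelve. all: by end_near.
Qed.

End Scalars.

(** * Cauchy products of finite sums *)

(** The square of all products minus the triangle i + j < N. Commutativity is not assumed, so that
    the same index set serves matrices and their real majorants. *)
Lemma sum_Cauchy_product_tail (P : pzRingType) (x y t : nat -> P) (N : nat) :
  (forall m, t m = \sum_(0 <= i < m.+1) x i * y (m - i)%N) ->
  (\sum_(0 <= i < N) x i) * (\sum_(0 <= j < N) y j) - \sum_(0 <= m < N) t m =
  \sum_(0 <= i < N) \sum_(N - i <= j < N) x i * y j.
Proof.
move=> ht; rewrite (eq_bigr _ (fun m _ => ht m)).
have -> : \sum_(0 <= m < N) \sum_(0 <= i < m.+1) x i * y (m - i)%N =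
    \sum_(0 <= i < N) \sum_(0 <= j < N - i) x i * y j.
  elim: N => [|N IH]; first by rewrite !big_geq.
  rewrite big_nat_recr //= IH [RHS]big_nat_recr //= subSnn big_nat1.
  rewrite [\sum_(0 <= i < N.+1) _]big_nat_recr //= subnn addrA -big_split /=.
  congr (_ + _); apply: eq_big_nat => i /andP[_ iN].
  by rewrite subSn ?(ltnW iN) // [RHS]big_nat_recr.
rewrite big_distrlr /= -sumrB; apply: eq_big_nat => i _.
by rewrite [\sum_(0 <= j < N) _](@big_cat_nat _ _ _ (N - i)%N) ?leq_subr //= addrC addrK.
Qed.

Lemma expr_divfactD (K : numFieldType) (z w : K) (m : nat) :
  (z + w) ^+ m / m`!%:R =
  \sum_(0 <= i < m.+1) (z ^+ i / i`!%:R) * (w ^+ (m - i) / (m - i)`!%:R).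
Proof.
rewrite addrC exprDn mulr_suml big_mkord; apply: eq_bigr => i _.
have fact0 q : (q`!%:R : K) != 0 by rewrite pnatr_eq0 -lt0n fact_gt0.
have : ('C(m, i) * (i`! * (m - i)`!))%:R = m`!%:R :> K.
  by rewrite bin_fact // -ltnS.
rewrite !natrM => <-; rewrite -mulr_natl.
have C0 : ('C(m, i)%:R : K) != 0 by rewrite pnatr_eq0 -lt0n bin_gt0 -ltnS.
by field; rewrite ?fact0 ?C0.
Qed.

(** * A submultiplicative matrix norm and completeness *)

Section MatrixModulus.
Variables (R : realType) (k : scalar_kind).
Local Notation F := (scalars R k).

Definition mxmod n (A : 'M[F]_n) : R := \sum_i \sum_j modulus (A i j).

Lemma mxmod_ge0 n (A : 'M[F]_n) : 0 <= mxmod A.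
Proof. by do 2!apply: sumr_ge0 => ? _; exact: modulus_ge0. Qed.

Lemma mxmod0 n : mxmod (0 : 'M[F]_n) = 0.
Proof.
rewrite /mxmod big1 // => i _; rewrite big1 // => j _.
by rewrite mxE modulus0.
Qed.

Lemma ler_mxmodD n (A B : 'M[F]_n) : mxmod (A + B) <= mxmod A + mxmod B.
Proof.
rewrite -big_split; apply: ler_sum => i _ /=.
rewrite -big_split; apply: ler_sum => j _ /=.
by rewrite mxE ler_modulusD.
Qed.

Lemma mxmodZ n a (A : 'M[F]_n) : mxmod (a *: A) = modulus a * mxmod A.
Proof.
rewrite mulr_sumr; apply: eq_bigr => i _; rewrite mulr_sumr.
by apply: eq_bigr => j _; rewrite mxE modulusM.
Qed.

Lemma mxmodN n (A : 'M[F]_n) : mxmod (- A) = mxmod A.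
Proof. by do 2!apply: eq_bigr => ? _; rewrite mxE modulusN. Qed.

Lemma mxmodBC n (A B : 'M[F]_n) : mxmod (A - B) = mxmod (B - A).
Proof. by rewrite -mxmodN opprB. Qed.

Lemma ler_mxmodB n (A B C : 'M[F]_n) :
  mxmod (A - C) <= mxmod (A - B) + mxmod (B - C).
Proof. by rewrite -(subrKA B) ler_mxmodD. Qed.

Lemma ler_mxmod_sum n (I : Type) (r : seq I) (P : pred I) (A : I -> 'M[F]_n) :
  mxmod (\sum_(i <- r | P i) A i) <= \sum_(i <- r | P i) mxmod (A i).
Proof.
elim/big_ind2 : _ => //; first by rewrite mxmod0.
by move=> A1 x A2 y h1 h2; apply: le_trans (ler_mxmodD _ _) (lerD h1 h2).
Qed.

Lemma ler_modulus_mxmod n (A : 'M[F]_n) i j : modulus (A i j) <= mxmod A.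
Proof.
rewrite /mxmod (bigD1 i) //= (bigD1 j) //= -addrA lerDl.
by rewrite addr_ge0 // sumr_ge0 // => *; rewrite ?sumr_ge0 // => *; exact: modulus_ge0.
Qed.

Lemma ler_mxmodM n (A B : 'M[F]_n) : mxmod (A * B) <= mxmod A * mxmod B.
Proof.
rewrite /mxmod mulr_suml; apply: ler_sum => i _.
apply: (@le_trans _ _ (\sum_j \sum_l modulus (A i l) * modulus (B l j))).
  apply: ler_sum => j _; rewrite mxE.
  elim/big_ind2 : _ => //; first by rewrite modulus0.
    by move=> a x b y h1 h2; apply: le_trans (ler_modulusD _ _) (lerD h1 h2).
  by move=> l _; rewrite modulusM.
rewrite exchange_big /= mulr_suml; apply: ler_sum => l _.
rewrite -mulr_sumr ler_wpM2l ?modulus_ge0 //.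
rewrite [leRHS](bigD1 l) //= lerDl.
by do 2!apply: sumr_ge0 => ? _; exact: modulus_ge0.
Qed.

(** Splitting off the identity costs a factor 1, where submultiplicativity alone would cost
    [mxmod 1], which is n. Powers of matrices near 1 thus escape a factor n^m. *)
Lemma ler_mxmod1DM n (D B : 'M[F]_n) :
  mxmod ((1 + D) * B) <= (1 + mxmod D) * mxmod B.
Proof.
rewrite mulrDl mul1r mulrDl mul1r.
by apply: le_trans (ler_mxmodD _ _) _; rewrite lerD2l ler_mxmodM.
Qed.

Lemma ler_mxmod1D n (D B : 'M[F]_n) m :
  mxmod (B * (1 + D) ^+ m) <= mxmod B * (1 + mxmod D) ^+ m.
Proof.
elim: m => [|m IH]; first by rewrite !expr0 !mulr1.
rewrite !exprSr !mulrA mulrDr mulr1 [leRHS]mulrDr mulr1.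
apply: le_trans (ler_mxmodD _ _) _; apply: lerD => //.
by apply: le_trans (ler_mxmodM _ _) _; rewrite ler_wpM2r ?mxmod_ge0.
Qed.

(** The constant pays for m = 0; its summand 1 keeps it positive for empty matrices too, so that it
    can be divided by. *)
Lemma ler_mxmodX n (G : 'M[F]_n) m :
  mxmod (G ^+ m) <= (1 + mxmod (1 : 'M[F]_n)) * mxmod G ^+ m.
Proof.
elim: m => [|m IH]; first by rewrite !expr0 mulr1 lerDr.
rewrite !exprSr mulrA; apply: le_trans (ler_mxmodM _ _) _.
by rewrite ler_wpM2r ?mxmod_ge0.
Qed.

(* Telescoping: [a^m - b^m] is the sum of the [a^i (a - b) b^(m - 1 - i)]. *)
Lemma ler_mxmod_subX n (A B : 'M[F]_n) (c : R) m :
  1 + mxmod (A - 1) <= c -> 1 + mxmod (B - 1) <= c ->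
  mxmod (A ^+ m - B ^+ m) <= m%:R * (c ^+ m * mxmod (A - B)).
Proof.
move=> hA hB.
have c1 : 1 <= c by apply: le_trans hA; rewrite lerDl mxmod_ge0.
elim: m => [|m IH]; first by rewrite !expr0 subrr mxmod0 mul0r.
have -> : A ^+ m.+1 - B ^+ m.+1 =
    (1 + (A - 1)) * (A ^+ m - B ^+ m) + (A - B) * (1 + (B - 1)) ^+ m.
  by rewrite !subrKC mulrBr mulrBl -!exprS addrA subrK.
apply: le_trans (ler_mxmodD _ _) _.
apply: (@le_trans _ _ (c * (m%:R * (c ^+ m * mxmod (A - B)))
    + mxmod (A - B) * c ^+ m)).
  apply: lerD.
    apply: le_trans (ler_mxmod1DM _ _) _.
    by rewrite ler_pM // ?mxmod_ge0 // addr_ge0 // mxmod_ge0.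
  apply: le_trans (ler_mxmod1D _ _ _) _.
  rewrite ler_wpM2l ?mxmod_ge0 // lerXn2r // nnegrE ?addr_ge0 ?mxmod_ge0 //.
  exact: le_trans c1.
rewrite -natr1 mulrDl mul1r exprS; apply: lerD.
  by rewrite le_eqVlt; apply/orP; left; apply/eqP; ring.
rewrite mulrC -mulrA ler_peMl // mulr_ge0 ?mxmod_ge0 // exprn_ge0 //.
exact: le_trans c1.
Qed.

Lemma cvg_mxmod n (I : Type) (Fl : set_system I) {FF : Filter Fl}
    (U : I -> 'M[F]_n) (L : 'M[F]_n) :
  (forall i j, U t i j @[t --> Fl] --> L i j) ->
  forall e : R, 0 < e -> \forall t \near Fl, mxmod (U t - L) < e.
Proof.
move=> UL e e0.
(* One more than the number of entries: the sum of the entry bounds is then strictly below e, also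
   for n = 0. *)
have e'0 : 0 < e / (n * n).+1%:R by rewrite divr_gt0.
have : \forall t \near Fl, forall i j, modulus (U t i j - L i j) < e / (n * n).+1%:R.
  apply: filter_forall => i; apply: filter_forall => j.
  by have /cvg_modulusP := UL i j; exact.
apply: filterS => t h.
apply: (@le_lt_trans _ _ (\sum_(i < n) \sum_(j < n) e / (n * n).+1%:R)).
  by do 2!apply: ler_sum => ? _; rewrite !mxE ltW.
rewrite !sumr_const !card_ord -mulrnA -[_ *+ (n * n)]mulr_natl mulrCA.
by rewrite gtr_pMr // ltr_pdivrMr ?mul1r ?ltr_nat.
Qed.

Lemma mx_complete n (U : nat -> 'M[F]_n) :
  (forall e : R, 0 < e -> exists N, forall p q, (N <= p)%N -> (N <= q)%N ->
     mxmod (U p - U q) < e) ->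
  exists L : 'M[F]_n, forall i j, U t i j @[t --> \oo] --> L i j.
Proof.
move=> hU.
have /choice[f hf] : forall ij : 'I_n * 'I_n,
    exists l : F, U t ij.1 ij.2 @[t --> \oo] --> l.
  move=> [i j] /=; apply: scalars_complete => e /hU[N hN].
  exists N => p q Np Nq; apply: le_lt_trans (hN _ _ Np Nq).
  by have := ler_modulus_mxmod (U p - U q) i j; rewrite !mxE.
by exists (\matrix_(i, j) f (i, j)) => i j; rewrite mxE; exact: (hf (i, j)).
Qed.

Lemma cvg_mulmx n (U V : nat -> 'M[F]_n) (L M : 'M[F]_n) :
  (forall i j, U t i j @[t --> \oo] --> L i j) ->
  (forall i j, V t i j @[t --> \oo] --> M i j) ->
  forall i j, (U t * V t) i j @[t --> \oo] --> (L * M) i j.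
Proof.
move=> UL VM i j; rewrite mxE.
under eq_fun do rewrite mxE.
apply: cvg_big => [|l _]; [exact: add_continuous|exact: cvgM].
Qed.

Lemma mxmod_le0_eq n (A B : 'M[F]_n) : mxmod (A - B) <= 0 -> A = B.
Proof.
move=> AB; apply/eqP; rewrite -subr_eq0; apply/eqP/matrixP => i j.
rewrite [RHS]mxE; apply: normr0_eq0; rewrite -of_real_modulus.
have := le_trans (ler_modulus_mxmod (A - B) i j) AB.
rewrite le_eqVlt ltNge modulus_ge0 orbF => /eqP ->; exact: rmorph0.
Qed.

(** Closed balls are closed. Estimates and identities for [mxexp] come from bounding partial sums
    and passing to the limit through this. *)
Lemma cvg_mxmod_le n (U : nat -> 'M[F]_n) (L M : 'M[F]_n) (e : R) :
  (forall i j, U t i j @[t --> \oo] --> L i j) ->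
  (\forall t \near \oo, mxmod (U t - M) <= e) -> mxmod (L - M) <= e.
Proof.
move=> /cvg_mxmod UL UM; apply/ler_addgt0Pr => e' /UL ULe'.
near \oo => t; apply: le_trans (ler_mxmodB _ (U t) _) _.
rewrite addrC lerD //; first by near: t.
by rewrite mxmodBC ltW //; near: t.
Unshelve. all: by end_near.
Qed.

End MatrixModulus.

(** * The matrix exponential *)

Lemma cvg_series_expR (R : realType) (x : R) :
  series (exp_coeff x) N @[N --> \oo] --> expR x.
Proof. exact: is_cvg_series_exp_coeff. Qed.

Lemma ler_series_expR (R : realType) (x : R) N :
  0 <= x -> series (exp_coeff x) N <= expR x.
Proof.
move=> x0; have -> : expR x = limn (series (exp_coeff x)) by [].
apply: nondecreasing_cvgn_le; last exact: is_cvg_series_exp_coeff.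
apply/nondecreasing_seqP => m.
by rewrite !seriesEnat /= big_nat_recr //= lerDl /exp_coeff /= divr_ge0 // exprn_ge0.
Qed.

Lemma mul_scalemx (K : comPzRingType) n (a b : K) (A B : 'M[K]_n) :
  (a *: A) * (b *: B) = (a * b) *: (A * B).
Proof. by rewrite -[LHS]/(_ *m _) -scalemxAl -scalemxAr scalerA. Qed.

Section MatrixExponential.
Variables (R : realType) (k : scalar_kind) (n : nat).
Local Notation F := (scalars R k).
Variable G : 'M[F]_n.
Implicit Types (z w : F).

Definition expmx N z : 'M[F]_n := \sum_(0 <= i < N) (z ^+ i / i`!%:R) *: G ^+ i.

Definition mxexp z : 'M[F]_n :=
  \matrix_(i, j) lim (expmx N z i j @[N --> \oo]).

Let c := 1 + mxmod (1 : 'M[F]_n).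
Let g := mxmod G.

Let c_ge0 : 0 <= c. Proof. by rewrite addr_ge0 ?mxmod_ge0. Qed.
Let g_ge0 : 0 <= g. Proof. exact: mxmod_ge0. Qed.

(** Links the matrix series to the real exponential series at [modulus z * g], which majorises it up
    to the factor [c]. *)
Let expmx_coeffX (z : F) (a : R) i : modulus z = a ->
  modulus (z ^+ i / i`!%:R) * g ^+ i = exp_coeff (a * g) i.
Proof.
by move=> <-; rewrite modulusM modulusV modulusX modulus_nat /exp_coeff /= exprMn mulrAC.
Qed.

Let ler_expmx_tail z p q :
  mxmod (\sum_(p <= i < q) (z ^+ i / i`!%:R) *: G ^+ i) <=
  c * \sum_(p <= i < q) exp_coeff (modulus z * g) i.
Proof.
apply: le_trans (ler_mxmod_sum _ _ _) _; rewrite mulr_sumr; apply: ler_sum => i _.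
rewrite mxmodZ -(expmx_coeffX i (erefl (modulus z))) mulrCA ler_wpM2l ?modulus_ge0 //.
exact: ler_mxmodX.
Qed.

Lemma cvg_expmx z i j : expmx N z i j @[N --> \oo] --> mxexp z i j.
Proof.
suff [L hL] : exists L : 'M[F]_n, forall i j, expmx N z i j @[N --> \oo] --> L i j.
  rewrite mxE; suff -> : lim (expmx N z i j @[N --> \oo]) = L i j by exact: hL.
  by apply: cvg_lim; [exact: norm_hausdorff|exact: hL].
apply: mx_complete => e e0.
set s := series (exp_coeff (modulus z * g)).
(* The factor c comes from the tail bound; the half, from comparing two partial sums through their
   limit [expR]. *)
have e'0 : 0 < e / c / 2.
  by rewrite !divr_gt0 // ltr_pwDl // mxmod_ge0.
have /cvgrPdist_lt/(_ _ e'0)[N _ hN] := @cvg_series_expR R (modulus z * g).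
exists N; suff H p q : (N <= p)%N -> (p <= q)%N -> mxmod (expmx p z - expmx q z) < e.
  move=> p q Np Nq; case/orP: (leq_total p q) => pq; first exact: H.
  by rewrite mxmodBC; exact: H.
move=> Np pq; rewrite mxmodBC /expmx (@big_cat_nat _ _ _ p) //= addrAC subrr add0r.
apply: le_lt_trans (ler_expmx_tail _ _ _) _.
have -> : \sum_(p <= i < q) exp_coeff (modulus z * g) i = s q - s p.
  by rewrite /s !seriesEnat /= (@big_cat_nat _ _ _ p 0 q) //= addrAC subrr add0r.
rewrite mulrC -ltr_pdivlMr; last by rewrite ltr_pwDl // mxmod_ge0.
have := hN p Np; have := hN q (leq_trans Np pq).
rewrite /= -/s => h1 h2; rewrite (splitr (e / c)).
apply: le_lt_trans (ler_norm _) _.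
rewrite -(subrKA (expR (modulus z * g))).
by apply: le_lt_trans (ler_normD _ _) _; rewrite ltrD // distrC.
Qed.

Lemma mxexp0 : mxexp 0 = 1.
Proof.
apply: mxmod_le0_eq; apply: (@cvg_mxmod_le _ _ _ (fun N => expmx N 0)).
  by move=> i j; exact: cvg_expmx.
exists 1%N => // -[//|N] _ /=.
rewrite /expmx big_nat_recl //= big1 ?addr0 => [|i _].
  by rewrite expr0 divr1 scale1r expr0 subrr mxmod0.
by rewrite expr0n mul0r scale0r.
Qed.

(** The product of the partial sums differs from the partial sum at z + w by a square minus a
    triangle. Term by term this is at most c times the same difference for the real majorants, which
    tends to 0 because [expR] is multiplicative. *)
Lemma mxexpD z w : mxexp (z + w) = mxexp z * mxexp w.
Proof.
apply/esym/mxmod_le0_eq; rewrite -[_ - _]subr0.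
set a := modulus z * g; set b := modulus w * g.
apply/ler_addgt0Pr => e e0; rewrite add0r.
apply: (@cvg_mxmod_le _ _ _ (fun N => expmx N z * expmx N w - expmx N (z + w))).
  move=> i j; have -> : (mxexp z * mxexp w - mxexp (z + w)) i j =
      (mxexp z * mxexp w) i j - mxexp (z + w) i j by rewrite !mxE.
  under eq_fun do rewrite mxE [X in _ + X]mxE.
  by apply: cvgB; [apply: cvg_mulmx => ? ?|]; exact: cvg_expmx.
have cvgs : c * (series (exp_coeff a) N * series (exp_coeff b) N
    - series (exp_coeff (a + b)) N) @[N --> \oo] --> (0 : R).
  have -> : 0 = c * (expR a * expR b - expR (a + b)) by rewrite expRD subrr mulr0.
  by apply: cvgMr; apply: cvgB; [apply: cvgM|]; exact: cvg_series_expR.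
have /cvgrPdist_lt/(_ _ e0) := cvgs.
apply: filterS => N hN; apply: le_trans (ltW hN); rewrite sub0r normrN.
apply: le_trans (ler_norm _); rewrite subr0 !seriesEnat.
rewrite /expmx (@sum_Cauchy_product_tail 'M[F]_n); last first.
  move=> m; rewrite expr_divfactD scaler_suml; apply: eq_big_nat => i /andP[_ im].
  by rewrite mul_scalemx -exprD subnKC.
rewrite (@sum_Cauchy_product_tail R); last first.
  by move=> m; rewrite /exp_coeff /= expr_divfactD.
apply: le_trans (ler_mxmod_sum _ _ _) _; rewrite mulr_sumr; apply: ler_sum => i _.
apply: le_trans (ler_mxmod_sum _ _ _) _; rewrite mulr_sumr; apply: ler_sum => j _.
rewrite mul_scalemx -exprD mxmodZ modulusM.
rewrite -(expmx_coeffX i (erefl (modulus z))) -(expmx_coeffX j (erefl (modulus w))).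
rewrite mulrACA -exprD mulrCA ler_wpM2l ?mulr_ge0 ?modulus_ge0 //.
exact: ler_mxmodX.
Qed.

(** For s <= 1 and i >= 2 one has s^i <= s^2, so the remainder is at most c s^2 times the whole
    series of exp g. *)
Lemma mxexp_taylor1 : exists2 C : R, 0 <= C & forall s : R, 0 <= s -> s <= 1 ->
  mxmod (mxexp (of_real k s) - (1 + of_real k s *: G)) <= C * s ^+ 2.
Proof.
exists (c * expR g); first by rewrite mulr_ge0 ?expR_ge0.
move=> s s0 s1; apply: (@cvg_mxmod_le _ _ _ (expmx ^~ (of_real k s))) => [i j|].
  exact: cvg_expmx.
exists 2%N => // N /= N2; rewrite /expmx (@big_cat_nat _ _ _ 2) //=.
rewrite !big_nat_recr //= big_geq // add0r expr0 expr1 !fact0 factS fact0 muln1 !divr1.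
rewrite expr0 expr1 scale1r addrAC subrr add0r.
apply: le_trans (ler_expmx_tail _ _ _) _; rewrite -mulrA ler_wpM2l //.
rewrite modulus_of_real // [leRHS]mulrC.
apply: le_trans (ler_wpM2l (exprn_ge0 2 s0) (ler_series_expR N g_ge0)).
rewrite seriesEnat /= [X in _ <= _ * X](@big_cat_nat _ _ _ 2) //= mulrDr.
rewrite ler_wpDl //.
  rewrite mulr_ge0 ?exprn_ge0 // sumr_ge0 // => i _.
  by rewrite /exp_coeff /= divr_ge0 // exprn_ge0.
rewrite [leRHS]mulr_sumr; apply: ler_sum_nat => i /andP[i2 _].
rewrite /exp_coeff /= mulrA ler_wpM2r ?invr_ge0 // exprMn ler_wpM2r ?exprn_ge0 //.
by rewrite -(subnK i2) exprD ler_piMl ?exprn_ge0 // exprn_ile1.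
Qed.

End MatrixExponential.

(** * Matrix semigroups that are right-continuous at 0 *)

Lemma exists_nat_div_lt (R : archiRealFieldType) (C e : R) (m0 : nat) :
  0 <= C -> 0 < e ->
  exists m, [/\ (m0 <= m)%N, (0 < m)%N & C / m%:R < e].
Proof.
move=> C0 e0; exists (maxn m0 (Num.truncn (C / e)).+1); split.
- exact: leq_maxl.
- by rewrite (leq_trans _ (leq_maxr _ _)).
- have m1 := leq_maxr m0 (Num.truncn (C / e)).+1.
  rewrite ltr_pdivrMr; last by rewrite ltr0n (leq_trans _ m1).
  rewrite mulrC -ltr_pdivrMr //.
  by apply: lt_le_trans (truncnS_gt _) _; rewrite ler_nat.
Qed.

Section MatrixSemigroup.
Variables (R : realType) (k : scalar_kind) (n : nat).
Variable A : R -> 'M[scalars R k]_n.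
Hypothesis A0 : A 0 = 1.
Hypothesis AD : forall s t, 0 <= s -> 0 <= t -> A (s + t) = A s * A t.
Hypothesis A_right_continuous0 :
  forall i j, A s i j @[s --> (0 : R)^'+] --> (1 : 'M[scalars R k]_n) i j.
Let D s := A s - 1.

Lemma semigroupX s m : 0 <= s -> A (m%:R * s) = A s ^+ m.
Proof.
move=> s0; elim: m => [|m IH]; first by rewrite mul0r A0 expr0.
by rewrite -natr1 mulrDl mul1r AD ?mulr_ge0 // IH exprSr.
Qed.

(** The geometric sum for A_s^m - 1 with its main part m D s removed. Where D is small, this makes D
    nearly additive. *)
Lemma semigroup_sub1_sum s m : 0 <= s ->
  D (m%:R * s) - m%:R *: D s = D s * \sum_(j < m) D (j%:R * s).
Proof.
move=> s0; rewrite /D semigroupX // subrX1 sumrB mulrBr; congr (_ * _ - _).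
  by apply: eq_bigr => j _; rewrite semigroupX.
by rewrite sumr_const card_ord mulrnAr mulr1 scaler_nat.
Qed.

Lemma semigroup_near1 : exists2 dl : R, 0 < dl &
  forall s, 0 <= s -> s <= dl -> mxmod (D s) <= 4^-1.
Proof.
have q0 : (0 : R) < 4^-1 by rewrite invr_gt0.
have [e /= e0 he] := cvg_mxmod A_right_continuous0 q0.
(* Halving closes the range of s; the limit from the right says nothing at s = 0, which [A0]
   settles. *)
exists (e / 2); first by rewrite divr_gt0.
move=> s s0 se; move: s0; rewrite le_eqVlt => /predU1P[<-|s0].
  by rewrite /D A0 subrr mxmod0 ltW.
apply/ltW/he => //=; rewrite sub0r normrN gtr0_norm //.
by apply: le_lt_trans se _; rewrite ltr_pdivrMr // ltr_pMr // ltr1n.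
Qed.

(** A bootstrap from bounded to linear: let m be the largest integer with m s <= dl. Near-additivity
    gives m |D s| <= 1/4 + m |D s| / 4, hence m |D s| <= 1/2, and dl <= 2 m s then yields the slope
    1 / dl. *)
Lemma semigroup_lipschitz0 : exists2 dl : R, 0 < dl &
  forall s, 0 <= s -> s <= dl -> mxmod (D s) <= 4^-1 /\ mxmod (D s) <= dl^-1 * s.
Proof.
have [dl dl0 small] := semigroup_near1; exists dl => // s s0 sdl.
split; first exact: small.
move: s0; rewrite le_eqVlt => /predU1P[<-|s0].
  by rewrite /D A0 subrr mxmod0 mulr0.
have [] := andP (truncn_itv (ltW (divr_gt0 dl0 s0))).
set m := Num.truncn _ => ms sm.
have m0 : (0 < m)%N by rewrite truncn_gt0 ler_pdivlMr // mul1r.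
have msdl : m%:R * s <= dl by rewrite -ler_pdivlMr.
have le1 : m%:R * mxmod (D s) <= 4^-1 + mxmod (D s) * (m%:R * 4^-1).
  have -> : m%:R * mxmod (D s) = mxmod (m%:R *: D s) by rewrite mxmodZ modulus_nat.
  have -> : m%:R *: D s = D (m%:R * s) - D s * \sum_(j < m) D (j%:R * s).
    by rewrite -semigroup_sub1_sum ?ltW // subKr.
  apply: le_trans (ler_mxmodD _ _) _; rewrite mxmodN; apply: lerD.
    by apply: small => //; rewrite mulr_ge0 // ltW.
  apply: le_trans (ler_mxmodM _ _) _; rewrite ler_wpM2l ?mxmod_ge0 //.
  apply: le_trans (ler_mxmod_sum _ _ _) _.
  rewrite mulrC mulr_natr -[in leRHS](card_ord m) -sumr_const; apply: ler_sum => j _.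
  apply: small; first by rewrite mulr_ge0 // ltW.
  by apply: le_trans msdl; apply: ler_wpM2r; [exact: ltW|rewrite ler_nat ltnW].
have m1 : (1 : R) <= m%:R by rewrite ler1n.
have x0 := mxmod_ge0 (D s).
rewrite mulrC ler_pdivlMr //.
move: sm; rewrite ltr_pdivrMr // -natr1 => sm.
have : m%:R * mxmod (D s) <= 2^-1 by nra.
move: (mxmod _) x0 {le1} => x x0 mx.
have : dl <= 2 * m%:R * s by nra.
nra.
Qed.

(* With [K = dl^-1], [D (m h) = m D h + O((m h)^2)], so the quotients [D h / h]
   taken along [h = dl / m] form a Cauchy sequence. *)
Lemma semigroup_derivable0 :
  exists (G : 'M[scalars R k]_n) (K : R), exists2 dl : R, 0 < dl &
  [/\ 0 <= K, (forall s, 0 <= s -> s <= dl -> mxmod (D s) <= K * s) &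
  forall s, 0 <= s -> s <= dl ->
    mxmod (D s - of_real k s *: G) <= K ^+ 2 * s ^+ 2].
Proof.
have [dl dl0 small] := semigroup_lipschitz0.
set K := dl^-1; have K0 : 0 < K by rewrite invr_gt0.
have quad m h : 0 <= h -> m%:R * h <= dl ->
    mxmod (D (m%:R * h) - m%:R *: D h) <= K ^+ 2 * (m%:R * h) ^+ 2.
  move=> h0 mh; rewrite semigroup_sub1_sum //.
  case: m mh => [|m] mh; first by rewrite big_ord0 mulr0 mxmod0 mul0r expr0n mulr0.
  have small' j : (j <= m.+1)%N -> mxmod (D (j%:R * h)) <= K * (m.+1%:R * h).
    move=> jm; have jh : j%:R * h <= m.+1%:R * h by rewrite ler_wpM2r // ler_nat.
    have [||_] := small (j%:R * h); rewrite ?mulr_ge0 //; first exact: le_trans mh.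
    by move/le_trans; apply; rewrite ler_wpM2l // ltW.
  apply: le_trans (ler_mxmodM _ _) _.
  have -> : K ^+ 2 * (m.+1%:R * h) ^+ 2 =
      (K * h) * \sum_(j < m.+1) (K * (m.+1%:R * h)).
    by rewrite sumr_const card_ord -[_ *+ m.+1]mulr_natl; ring.
  apply: ler_pM; rewrite ?mxmod_ge0 //.
    have [||] := small h; rewrite ?mulr_ge0 //.
    by apply: le_trans mh; rewrite ler_peMl // ler1n.
  apply: le_trans (ler_mxmod_sum _ _ _) _; apply: ler_sum => j _.
  by apply: small'; exact: ltnW.
pose q (m : nat) : R := dl / m%:R.
have q_gt0 m : (0 < m)%N -> 0 < q m by move=> m0; rewrite divr_gt0 ?ltr0n.
pose M (m : nat) := of_real k (q m)^-1 *: D (q m).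
have quotient m p : (0 < m)%N -> (0 < p)%N ->
    mxmod (M m - M (m * p)%N) <= K ^+ 2 * q m.
  move=> m0 p0; have qp : q m = p%:R * q (m * p)%N.
    by rewrite /q natrM; field; rewrite !pnatr_eq0 -!lt0n m0 p0.
  have qmp0 : 0 < q (m * p)%N by rewrite q_gt0 // muln_gt0 m0.
  have -> : M m - M (m * p)%N =
      of_real k (q m)^-1 *: (D (p%:R * q (m * p)%N) - p%:R *: D (q (m * p)%N)).
    rewrite scalerBr scalerA -qp; congr (_ - _ *: _).
    rewrite -(rmorph_nat (@of_real R k)) -rmorphM; congr of_real.
    by rewrite qp; field; rewrite pnatr_eq0 -lt0n p0 gt_eqF.
  rewrite mxmodZ modulus_of_real ?invr_ge0 ?(ltW (q_gt0 _ m0)) //.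
  rewrite mulrC ler_pdivrMr ?q_gt0 // -mulrA -expr2 qp; apply: quad; first exact: ltW.
  by rewrite -qp /q ler_pdivrMr ?ltr0n // ler_peMr ?ler1n // ltW.
(* Both quotients are compared with the one at the common refinement m p of the two steps. *)
have diff m p : (0 < m)%N -> (0 < p)%N ->
    mxmod (M m - M p) <= K ^+ 2 * q m + K ^+ 2 * q p.
  move=> m0 p0; apply: le_trans (ler_mxmodB _ (M (m * p)%N) _) _.
  by apply: lerD; [exact: quotient|rewrite mxmodBC mulnC; exact: quotient].
have K2 : 0 <= K ^+ 2 by rewrite exprn_ge0 // ltW.
have q_mono m p : (0 < m)%N -> (m <= p)%N -> q p <= q m.
  move=> m0 mp; have p0 := leq_trans m0 mp.
  by rewrite /q (ler_pM2l dl0) lef_pV2 ?posrE ?ltr0n ?ler_nat.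
have [G MG] : exists G : 'M[scalars R k]_n,
    forall i j, M t i j @[t --> \oo] --> G i j.
  apply: mx_complete => e e0.
  have C0 : 0 <= 2 * (K ^+ 2 * dl) by rewrite !mulr_ge0 // ltW.
  have [N [_ N0 hN]] := exists_nat_div_lt 0 C0 e0.
  exists N => m p Nm Np; apply: le_lt_trans (diff m p _ _) _;
    rewrite ?(leq_trans N0) //.
  have qN : 2 * (K ^+ 2 * dl) / N%:R = K ^+ 2 * (2 * q N) by rewrite /q; ring.
  apply: le_lt_trans hN; rewrite -mulrDr qN.
  by apply: ler_wpM2l => //; rewrite mulrDl mul1r lerD // q_mono.
have GM m : (0 < m)%N -> mxmod (G - M m) <= K ^+ 2 * (2 * q m).
  move=> m0; apply: (cvg_mxmod_le MG); exists m => // p /= mp.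
  apply: le_trans (diff p m _ _) _; rewrite ?(leq_trans m0) //.
  by rewrite -mulrDr; apply: ler_wpM2l => //; rewrite mulrDl mul1r lerD // q_mono.
(* Half the radius, because the grid point p h used below may exceed s by up to h <= dl / 2 and must
   not exceed dl. *)
exists G, K, (dl / 2); first by rewrite divr_gt0.
have dl2 : dl / 2 <= dl by rewrite ler_pdivrMr // ler_peMr ?ler1n // ltW.
split; first exact: ltW.
  by move=> s s0 sdl; have [||_] := small s; rewrite // (le_trans sdl).
move=> s s0 sdl; have sdl' := le_trans sdl dl2.
have G0 := mxmod_ge0 G.
have Kdl : K * dl = 1 by rewrite mulVf // gt_eqF.
apply/ler_addgt0Pr => e e0.
(* The 7 collects the multiples of K h: 2 in [e1], 2 in [e3], and 3 in [e9] from expanding (s +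
   h)^2. Asking for m >= 2 gives h <= dl / 2. *)
have C0 : 0 <= dl * (7 * K + mxmod G) by rewrite mulr_ge0 ?addr_ge0 ?mulr_ge0 // ltW.
have [m [m2 m0 hm]] := exists_nat_div_lt 2 C0 e0.
pose h := q m; have h0 : 0 < h := q_gt0 m m0.
have hdl : h <= dl / 2 by rewrite /h /q (ler_pM2l dl0) lef_pV2 ?posrE ?ltr0n ?ler_nat.
have [p_le p_lt] := andP (truncn_itv (divr_ge0 s0 (ltW h0))).
pose p := (Num.truncn (s / h)).+1.
have sp : s <= p%:R * h by rewrite -ler_pdivrMr // ltW.
have ps : p%:R * h <= s + h.
  by rewrite /p -natr1 mulrDl mul1r lerD2r -ler_pdivlMr.
have pdl : p%:R * h <= dl by apply: le_trans ps _; rewrite (splitr dl) lerD.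
(* Four errors: moving s up to the grid point p h, the additivity defect of D there, the quotient D
   h / h against G, and G over the leftover time p h - s. *)
have -> : D s - of_real k s *: G =
    - (A s * D (p%:R * h - s)) + (D (p%:R * h) - p%:R *: D h)
    + (p%:R *: D h - of_real k (p%:R * h) *: G) + of_real k (p%:R * h - s) *: G.
  have -> : A s * D (p%:R * h - s) = D (p%:R * h) - D s.
    rewrite mulrBr mulr1 -AD // ?subr_ge0 // subrKC /D.
    by rewrite opprB addrA subrK.
  by rewrite opprB rmorphB scalerBl !subrKA.
have e1 : mxmod (A s * D (p%:R * h - s)) <= 2 * (K * h).
  rewrite -[A s](subrKC 1); apply: le_trans (ler_mxmod1DM _ _) _.
  have phs : p%:R * h - s <= h by rewrite lerBlDl.
  have [||_ h1] := small (p%:R * h - s).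
  - by rewrite subr_ge0.
  - by rewrite (le_trans phs) // (le_trans hdl).
  have [//|//|h2 _] := small s.
  apply: ler_pM; rewrite ?addr_ge0 ?mxmod_ge0 //; first by move: h2; rewrite /D; lra.
  by apply: le_trans h1 _; rewrite ler_wpM2l // ltW.
have e2 := quad p h (ltW h0) pdl.
have e3 : mxmod (p%:R *: D h - of_real k (p%:R * h) *: G) <= 2 * (K * h).
  have -> : p%:R *: D h - of_real k (p%:R * h) *: G =
      of_real k (p%:R * h) *: (M m - G).
    rewrite /M -/h [RHS]scalerBr scalerA -rmorphM -mulrA mulfV ?gt_eqF // mulr1.
    by rewrite rmorph_nat.
  have ph0 : 0 <= p%:R * h by rewrite mulr_ge0 // ltW.
  rewrite mxmodZ modulus_of_real // mxmodBC.
  apply: (@le_trans _ _ (dl * (K ^+ 2 * (2 * h)))).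
    by apply: ler_pM; rewrite ?mxmod_ge0 //; exact: GM.
  rewrite le_eqVlt; apply/orP; left; apply/eqP.
  by rewrite -[2 * (K * h)]mul1r -Kdl; ring.
have e4 : mxmod (of_real k (p%:R * h - s) *: G) <= h * mxmod G.
  rewrite mxmodZ modulus_of_real ?subr_ge0 //.
  by apply: ler_wpM2r => //; rewrite lerBlDl.
apply: le_trans (ler_mxmodD _ _) _.
apply: le_trans (lerD (ler_mxmodD _ _) (lexx _)) _.
apply: le_trans (lerD (lerD (ler_mxmodD _ _) (lexx _)) (lexx _)) _.
rewrite mxmodN; apply: le_trans (lerD (lerD (lerD e1 e2) e3) e4) _.
have e5 : K ^+ 2 * (p%:R * h) ^+ 2 <= K ^+ 2 * (s + h) ^+ 2.
  by apply: ler_wpM2l => //; rewrite lerXn2r // nnegrE ?mulr_ge0 ?addr_ge0 // ltW.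
have e6 : h * (7 * K + mxmod G) <= e.
  by apply: le_trans _ (ltW hm); rewrite /h /q mulrAC.
have e7 : K * s <= 1 by rewrite -Kdl ler_wpM2l // ltW.
have e8 : K * h <= 1 by rewrite -Kdl ler_wpM2l ?(ltW K0) // (le_trans hdl).
have e9 : K ^+ 2 * (s + h) ^+ 2 <= K ^+ 2 * s ^+ 2 + 3 * (K * h).
  have -> : K ^+ 2 * (s + h) ^+ 2 =
    K ^+ 2 * s ^+ 2 + (2 * ((K * s) * (K * h)) + (K * h) * (K * h)) by ring.
  have Kh0 : 0 <= K * h by rewrite mulr_ge0 // ltW.
  have : (K * s) * (K * h) <= K * h by rewrite ler_piMl.
  have : (K * h) * (K * h) <= K * h by rewrite ler_piMl.
  lra.
lra.
Qed.

Theorem semigroup_mxexp : exists G : 'M[scalars R k]_n,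
  forall s, 0 <= s -> A s = mxexp G (of_real k s).
Proof.
have [G [K [dl dl0 [K0 lip der]]]] := semigroup_derivable0.
have [C C0 tay] := mxexp_taylor1 G.
exists G => s s0.
have mxexpX z m : mxexp G (m%:R * z) = mxexp G z ^+ m.
  elim: m => [|m IH]; first by rewrite mul0r mxexp0 expr0.
  by rewrite -natr1 mulrDl mul1r mxexpD IH exprSr.
(* For small x, K' x bounds the distance to 1 of both A x and the exponential, and C' x^2 bounds
   their mutual distance. *)
pose K' := K + C + mxmod G; pose C' := K ^+ 2 + C.
have K'0 : 0 <= K' by rewrite !addr_ge0 ?mxmod_ge0.
have C'0 : 0 <= C' by rewrite addr_ge0 // exprn_ge0.
apply: mxmod_le0_eq; apply/ler_addgt0Pr => e e0; rewrite add0r.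
have m0dl : 0 < Num.min dl 1 by rewrite lt_min dl0 /=.
(* From m1 on, s / m lies below both dl and 1, the ranges of the two expansions. *)
have [m1 [_ m1_gt0 hm1]] := exists_nat_div_lt 0 s0 m0dl.
(* Each of the m steps of length s / m contributes C' (s / m)^2, amplified by at most exp(K' s): in
   total this constant divided by m. *)
have B0 : 0 <= expR (K' * s) * (C' * s ^+ 2).
  by rewrite !mulr_ge0 ?expR_ge0 // exprn_ge0.
have [m [m1m m0 hm]] := exists_nat_div_lt m1 B0 e0.
pose x := s / m%:R.
have x0 : 0 <= x by rewrite divr_ge0.
have mx : m%:R * x = s by rewrite mulrC divfK // pnatr_eq0 -lt0n.
have : x < Num.min dl 1.
  apply: le_lt_trans hm1; apply: ler_wpM2l => //.
  by rewrite lef_pV2 ?posrE ?ltr0n ?ler_nat.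
rewrite lt_min => /andP[/ltW xdl /ltW x1].
have dA := der x x0 xdl; have lA := lip x x0 xdl; have dE := tay x x0 x1.
have AE : mxmod (A x - mxexp G (of_real k x)) <= C' * x ^+ 2.
  apply: le_trans (ler_mxmodB _ (1 + of_real k x *: G) _) _.
  rewrite mulrDl; apply: lerD; last by rewrite mxmodBC.
  by move: dA; rewrite /D opprD addrA.
have xx : x ^+ 2 <= x by rewrite expr2 ler_piMl.
have lE : mxmod (mxexp G (of_real k x) - 1) <= (C + mxmod G) * x.
  rewrite -(subrKA (1 + of_real k x *: G)); apply: le_trans (ler_mxmodD _ _) _.
  rewrite mulrDl; apply: lerD; first by apply: le_trans dE _; rewrite ler_wpM2l.
  by rewrite addrAC subrr add0r mxmodZ modulus_of_real // mulrC.
have -> : s = m%:R * x by [].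
rewrite semigroupX // rmorphM rmorph_nat mxexpX.
have leA : 1 + mxmod (A x - 1) <= expR (K' * x).
  apply: le_trans (expR_ge1Dx _); rewrite lerD2l; apply: le_trans lA _.
  by apply: ler_wpM2r => //; rewrite /K' -addrA lerDl addr_ge0 ?mxmod_ge0.
have leE : 1 + mxmod (mxexp G (of_real k x) - 1) <= expR (K' * x).
  apply: le_trans (expR_ge1Dx _); rewrite lerD2l; apply: le_trans lE _.
  by apply: ler_wpM2r => //; rewrite /K' -addrA lerDr.
apply: le_trans (ler_mxmod_subX m leA leE) _.
apply: le_trans (ltW hm).
have -> : expR (K' * x) ^+ m = expR (K' * s).
  by rewrite -expRM_natl -mx; congr expR; ring.
rewrite mulrCA -[leRHS]mulrA; apply: ler_wpM2l; first exact: expR_ge0.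
apply: le_trans (ler_wpM2l (ler0n _ m) AE) _.
rewrite le_eqVlt; apply/orP; left; apply/eqP.
by rewrite -mx; field; rewrite pnatr_eq0 -lt0n.
Qed.

End MatrixSemigroup.

(** * Linear algebra: cyclic spans and maximal minors *)

(** Take for m the largest index with a nonzero coefficient: the relation can be solved for the m-th
    iterate, so the span of the m iterates before it is stable under T. If m = 0, then p = 0. *)
Lemma iter_span_of_dependent (K : fieldType) (V : lmodType K) 
    (T : {linear V -> V}) (p : V) (d : nat) (c : 'I_d.+1 -> K) :
  (exists i, c i != 0) -> \sum_i c i *: iter i T p = 0 ->
  exists2 m : nat, (m <= d)%N &
    forall j, exists a : 'I_m -> K, iter j T p = \sum_i a i *: iter i T p.
Proof.
move=> [i0 ci0] cT.
case: (@arg_maxnP _ i0 (fun i => c i != 0) (@nat_of_ord _) ci0) => m cm mmax.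
exists m; first by rewrite -ltnS.
pose span w := exists a : 'I_m -> K, w = \sum_i a i *: iter i T p.
have span0 : span 0 by exists (fun=> 0); rewrite big1 // => i _; rewrite scale0r.
have spanZ a w : span w -> span (a *: w).
  move=> [b ->]; exists (fun i => a * b i); rewrite scaler_sumr.
  by apply: eq_bigr => i _; rewrite scalerA.
have spanD v w : span v -> span w -> span (v + w).
  move=> [a ->] [b ->]; exists (fun i => a i + b i); rewrite -big_split.
  by apply: eq_bigr => i _; rewrite scalerDl.
have span_sum (I : Type) (r : seq I) (P : pred I) (w : I -> V) :
    (forall i, P i -> span (w i)) -> span (\sum_(i <- r | P i) w i).
  by move=> h; elim/big_ind : _.
have span_lt i : (i < m)%N -> span (iter i T p).
  move=> im; exists (fun j => (j == Ordinal im)%:R).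
  rewrite (bigD1 (Ordinal im)) //= eqxx scale1r big1 ?addr0 // => j /negPf ->.
  by rewrite scale0r.
have span_m : span (iter m T p).
  have -> : iter m T p = (c m)^-1 *: - \sum_(i | i != m) c i *: iter i T p.
    move: cT; rewrite (bigD1 m) //= => /eqP; rewrite addr_eq0 => /eqP <-.
    by rewrite scalerA mulVf // scale1r.
  apply: (spanZ); rewrite -scaleN1r; apply: (spanZ); apply: span_sum => i im.
  have [->|ci] := eqVneq (c i) 0; first by rewrite scale0r.
  apply: (spanZ); apply: span_lt; rewrite ltn_neqAle.
  by apply/andP; split; [exact: im|exact: mmax].
have span_le i : (i <= m)%N -> span (iter i T p).
  by rewrite leq_eqVlt => /predU1P[->|/span_lt].
elim=> [|j [a ja]]; first exact: (span_le 0%N).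
rewrite iterS ja linear_sum; apply: span_sum => i _ /=.
by rewrite linearZ; apply: spanZ; exact: (span_le i.+1).
Qed.

(** Read u as a matrix with rows I and columns Y. Bordering a largest invertible minor by row i and
    column z gives a singular matrix, whose Schur complement must vanish; this is the interpolation
    formula. *)
Lemma maximal_minor (K : fieldType) (I Y : Type) (u : I -> Y -> K) (d : nat) :
  (forall r (f : 'I_r -> I) (y : 'I_r -> Y),
     (\matrix_(i, j) u (f i) (y j)) \in unitmx -> (r <= d)%N) ->
  exists r (f : 'I_r -> I) (y : 'I_r -> Y),
    let M := \matrix_(i, j) u (f i) (y j) in
    M \in unitmx /\
    forall i z, u i z = \sum_j u i (y j) * \sum_l invmx M j l * u (f l) z.
Proof.
move=> bounded.
pose P r := `[< exists (f : 'I_r -> I) (y : 'I_r -> Y),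
  (\matrix_(i, j) u (f i) (y j)) \in unitmx >].
have exP : exists r, P r.
  (* The empty minor has determinant 1, so a largest size exists even if u is zero. *)
  exists 0%N; apply/asboolP; have f0 (T : Type) : 'I_0 -> T by case.
  by exists (f0 I), (f0 Y); rewrite unitmxE det_mx00 unitr1.
have boundP r : P r -> (r <= d)%N by move=> /asboolP[f [y]]; exact: bounded.
case: (ex_maxnP exP boundP) => r /asboolP[f [y Mu]] maxr.
exists r, f, y; split=> // i z; move: Mu; set M := \matrix_(_, _) _ => Mu.
pose f' (a : 'I_(r + 1)) := if fintype.split a is inl a' then f a' else i.
pose y' (a : 'I_(r + 1)) := if fintype.split a is inl a' then y a' else z.
pose b : 'cV[K]_r := \col_l u (f l) z.
pose c : 'rV[K]_r := \row_l u i (y l).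
have detB : \det (block_mx M b c (u i z)%:M) == 0.
  apply/negPn/negP => detB; suff /maxr : P (r + 1)%N by rewrite addn1 ltnn.
  apply/asboolP; exists f', y'; rewrite unitmxE unitfE.
  suff -> : \matrix_(a, a') u (f' a) (y' a') = block_mx M b c (u i z)%:M by [].
  apply/matrixP => a a'; rewrite mxE /block_mx !mxE /f' /y'.
  case: (fintype.split a) => a1; rewrite !mxE;
  by case: (fintype.split a') => a2; rewrite !mxE // !ord1 mulr1n.
(* A left kernel vector (v1, t) satisfies v1 M = - t c. Here t is nonzero, since otherwise v1 would
   vanish too, M being invertible; dividing by t gives u i z = c M^-1 b. *)
have [v v0] := det0P detB.
rewrite -(hsubmxK v) mul_row_block -row_mx0 => /eq_row_mx[].
set v1 := lsubmx v; set v2 := rsubmx v; set t := v2 0 0.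
have v2E : v2 = t%:M by rewrite [LHS]mx11_scalar.
rewrite v2E !mul_scalar_mx => /eqP; rewrite addr_eq0 => /eqP v1M v1b.
have v1E : v1 = - t *: (c *m invmx M).
  by rewrite scalemxAl scaleNr -v1M mulmxK.
have t0 : t != 0.
  apply: contraNneq v0 => t0.
  by rewrite -(hsubmxK v) -/v1 -/v2 v1E v2E t0 oppr0 scale0r raddf0 row_mx0.
have cMb : (u i z)%:M = c *m invmx M *m b.
  move: v1b; rewrite v1E -scalemxAl scaleNr addrC => /eqP; rewrite subr_eq0 => /eqP.
  exact: (scalerI t0).
have := congr1 (fun X : matrix K 1 1 => X 0 0) cMb.
rewrite -mulmxA mxE eqxx mulr1n mxE => ->; apply: eq_bigr => j _.
rewrite !mxE; congr (_ * _); apply: eq_bigr => l _; by rewrite !mxE.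
Qed.

(** * A finite-dimensional invariant space containing the orbit of p *)

Section PolynomialAction.
Variables (R : realType) (k : scalar_kind) (E : Type).
Local Notation F := (scalars R k).
Variable Pol : submodClosed (E -> F^o).
Local Notation V := (polynomial Pol).

Lemma peval_inj (p q : V) : (forall x, peval p x = peval q x) -> p = q.
Proof. by move=> pq; apply: val_inj; apply: funext. Qed.


Lemma pevalD (p q : V) x : peval (p + q) x = peval p x + peval q x.
Proof. by []. Qed.

Lemma pevalZ a (p : V) x : peval (a *: p) x = a * peval p x.
Proof. by []. Qed.

Lemma peval_sum (I : Type) (r : seq I) (P : pred I) (p : I -> V) x :
  peval (\sum_(i <- r | P i) p i) x = \sum_(i <- r | P i) peval (p i) x.
Proof. by elim/big_rec2 : _ => // i y1 y2 _ <-. Qed.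

Variables (deg : V -> nat) (T : R -> {linear V -> V}).
Hypothesis hT : is_polynomial_action deg T.

Lemma action_iter (h : R) j p : 0 <= h -> iter j (T h) p = T (j%:R * h) p.
Proof.
move=> h0; elim: j => [|j IH]; first by rewrite mul0r (action0 hT).
by rewrite iterS IH (actionD hT) ?mulr_ge0 // -nat1r mulrDl mul1r.
Qed.

Lemma exists_dyadic_between (a b : R) : 0 <= a -> a < b ->
  exists l j : nat, a < j%:R / 2 ^+ l < b.
Proof.
move=> a0 ab; have ba0 : 0 < b - a by rewrite subr_gt0.
have [l [_ l0 hl]] := exists_nat_div_lt 0 (@ler01 R) ba0.
have lt2l : (2 ^+ l)^-1 < b - a.
  apply: le_lt_trans hl; rewrite mul1r lef_pV2 ?posrE ?exprn_gt0 ?ltr0n //.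
  by rewrite -natrX ler_nat ltnW // ltn_expl.
have p2 : 0 < 2 ^+ l :> R by rewrite exprn_gt0.
have [j_le j_lt] := andP (truncn_itv (mulr_ge0 a0 (ltW p2))).
exists l, (Num.truncn (a * 2 ^+ l)).+1; apply/andP; split.
  by rewrite ltr_pdivlMr.
rewrite -natr1 mulrDl mul1r; apply: le_lt_trans (_ : a + (2 ^+ l)^-1 < b).
  by rewrite lerD2r ler_pdivrMr.
by rewrite -ltrBrDl.
Qed.

(** A pair (l, j) stands for the time j / 2^l. With l the largest exponent in use, all rows are
    values of iterates of one T_h, h = 2^-l, so the matrix factors through m <= d columns. *)
Lemma orbit_minor_le p : locally_finite T -> exists d,
  forall r (f : 'I_r -> nat * nat) (y : 'I_r -> E),
    (\matrix_(i, j) peval (T ((f i).2%:R / 2 ^+ (f i).1) p) (y j)) \in unitmx ->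
    (r <= d)%N.
Proof.
move=> /(_ p)[d hd]; exists d => r f y Mu.
pose l := (\max_i (f i).1)%N; pose h : R := (2 ^+ l)^-1.
have h0 : 0 < h by rewrite invr_gt0 exprn_gt0.
have [c c0 cT] := hd h h0.
have [m md spanT] := iter_span_of_dependent c0 cT.
have spanf i : exists a : 'I_m -> F,
    T ((f i).2%:R / 2 ^+ (f i).1) p = \sum_t a t *: iter t (T h) p.
  have fl : ((f i).1 <= l)%N by exact: (leq_bigmax i).
  have [a ha] := spanT ((f i).2 * 2 ^ (l - (f i).1))%N; exists a.
  rewrite -ha action_iter ?ltW //; congr (T _ p).
  rewrite natrM natrX -mulrA; congr (_ * _).
  by rewrite /h -(subnKC fl) addKn exprD invfM mulrCA mulfV ?mulr1 // expf_neq0.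
have [a ha] := choice spanf.
apply: leq_trans md; move: Mu.
have -> : \matrix_(i, j) peval (T ((f i).2%:R / 2 ^+ (f i).1) p) (y j) =
    (\matrix_(i, t) a i t) *m (\matrix_(t, j) peval (iter t (T h) p) (y j)).
  apply/matrixP => i j; rewrite !mxE ha peval_sum; apply: eq_bigr => t _.
  by rewrite !mxE pevalZ.
move/mxrank_unit => rk; rewrite -[X in (X <= _)%N]rk.
exact: leq_trans (mxrankM_maxl _ _) (rank_leq_col _).
Qed.

Lemma orbit_dual_basis p : locally_finite T ->
  exists r (e : 'I_r -> V) (y : 'I_r -> E),
  [/\ forall i j, peval (e i) (y j) = (i == j)%:R,
      forall h, 0 <= h -> T h p = \sum_j peval (T h p) (y j) *: e j &
      forall h i, 0 <= h -> T h (e i) = \sum_j peval (T h (e i)) (y j) *: e j].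
Proof.
move=> /(orbit_minor_le p)[d hd].
have [r [f [y]]] := @maximal_minor F (nat * nat) E
  (fun i z => peval (T (i.2%:R / 2 ^+ i.1) p) z) d hd.
set M := \matrix_(_, _) _ => -[Mu hM].
pose e j : V := \sum_l invmx M j l *: T ((f l).2%:R / 2 ^+ (f l).1) p.
have eE j z : peval (e j) z =
    \sum_l invmx M j l * peval (T ((f l).2%:R / 2 ^+ (f l).1) p) z.
  by rewrite peval_sum.
have Tp h : 0 <= h -> T h p = \sum_j peval (T h p) (y j) *: e j.
  move=> h0; apply: peval_inj => x; rewrite peval_sum.
  (* The interpolation error at x. It vanishes at dyadic times and is right-continuous, so a nonzero
     value at h would persist at some dyadic time just after h. *)
  pose phi s := peval (T s p) x - \sum_j peval (T s p) (y j) * peval (e j) x.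
  have phi_dyadic l j : phi (j%:R / 2 ^+ l) = 0.
    rewrite /phi (hM (l, j)) /= -sumrB big1 // => i _.
    by rewrite eE subrr.
  have phi_cvg : phi s @[s --> h^'+] --> phi h.
    apply: cvgB; first exact: (action_right_continuous hT).
    apply: cvg_big => [|j _]; first exact: add_continuous.
    by apply: cvgMl; exact: (action_right_continuous hT).
  suff : phi h = 0 by move/eqP; rewrite subr_eq0 => /eqP ->.
  apply/eqP/negPn/negP => phi_neq0.
  have mphi : 0 < modulus (phi h).
    by rewrite -(ltr_of_real k) of_real_modulus rmorph0 normr_gt0.
  have [eps /= eps0 heps] := (cvg_modulusP _ _).1 phi_cvg _ mphi.
  have hheps : h < h + eps by rewrite ltrDl.
  have [l [j /andP[hj jeps]]] := exists_dyadic_between h0 hheps.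
  have := heps (j%:R / 2 ^+ l).
  rewrite /= phi_dyadic sub0r modulusN ltxx => absurd; suff : false by [].
  by apply: absurd => //; rewrite ltr0_norm ?subr_lt0 // opprB ltrBlDl.
exists r, e, y; split=> //.
  move=> i j; rewrite eE; have := congr1 (fun X : matrix F r r => X i j) (mulVmx Mu).
  by rewrite !mxE => <-; apply: eq_bigr => l _; rewrite !mxE.
(* As e_i is a combination of orbit points, so is T_h e_i, and [Tp] expands each of them. *)
move=> h i h0; rewrite {1 2}/e linear_sum.
under [RHS]eq_bigr do rewrite peval_sum scaler_suml.
rewrite exchange_big; apply: eq_bigr => l _ /=.
have q0 : 0 <= (f l).2%:R / 2 ^+ (f l).1 :> R by rewrite divr_ge0 ?exprn_ge0.
rewrite linearZ /= (actionD hT) // {1}Tp ?addr_ge0 // scaler_sumr.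
by apply: eq_bigr => j _; rewrite scalerA.
Qed.

End PolynomialAction.

(** * The generator and its exponential series *)

Lemma cvg_mxexp_derivative (R : realType) (k : scalar_kind) n
    (G : 'M[scalars R k]_n) i j :
  ((of_real k h)^-1 *: (mxexp G (of_real k h) - 1)) i j
    @[h --> (0 : R)^'+] --> G i j.
Proof.
have [C C0 tay] := mxexp_taylor1 G.
apply/cvg_modulusP => e e0.
(* C may be 0, hence C + 1; the bound 1 on h below is the range of the expansion. *)
have eC : 0 < e / (C + 1) by rewrite divr_gt0 // ltr_wpDl.
have d0 : 0 < Num.min 1 (e / (C + 1)) by rewrite lt_min ltr01.
exists (Num.min 1 (e / (C + 1))) => // h /= + h0.
rewrite sub0r normrN gtr0_norm // lt_min => /andP[/ltW h1 he].
have hF : of_real k h != 0 by rewrite fmorph_eq0 gt_eqF.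
have -> : ((of_real k h)^-1 *: (mxexp G (of_real k h) - 1)) i j - G i j =
    ((of_real k h)^-1 *: (mxexp G (of_real k h) - (1 + of_real k h *: G))) i j.
  by rewrite opprD addrA [in RHS]scalerBr scalerA mulVf // scale1r !mxE.
apply: le_lt_trans (ler_modulus_mxmod _ _ _) _.
rewrite mxmodZ modulusV modulus_of_real ?ltW // mulrC ltr_pdivrMr //.
apply: le_lt_trans (tay h (ltW h0) h1) _; rewrite expr2 mulrA ltr_pM2r //.
move: he; rewrite ltr_pdivlMr ?ltr_wpDl // mulrC; apply: le_lt_trans.
by rewrite ler_wpM2r ?ltW // ltrDl.
Qed.

Section Generator.
Variables (R : realType) (k : scalar_kind) (E : Type).
Local Notation F := (scalars R k).
Variable Pol : submodClosed (E -> F^o).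
Local Notation V := (polynomial Pol).
Variables (deg : V -> nat) (T : R -> {linear V -> V}).
Hypothesis hT : is_polynomial_action deg T.
Hypothesis hlf : locally_finite T.

Lemma generatorE p q : is_derivative_at0 T p q -> generator T p = q.
Proof.
move=> pq; apply: (xget_unique _ pq) => q' pq'; apply: peval_inj => x.
exact: (cvg_unique (@norm_hausdorff _ _) (pq' x) (pq x)).
Qed.

Definition exp_series p x (z : F) N : F :=
  series (fun n => z ^+ n / n`!%:R * peval (iter n (generator T) p) x) N.

(** Coordinates are row vectors, so operators act by right multiplication. All v are covered, not
    only the one of p, because the group law applies the series again to a vector already moved
    inside the span. *)
Lemma local_exponential p : exists r (e : 'I_r -> V) (G : 'M[F]_r),
  let comb (v : 'rV[F]_r) := \sum_j v 0 j *: e j in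
  [/\ exists v, p = comb v,
    forall h v, 0 <= h -> T h (comb v) = comb (v *m mxexp G (of_real k h)),
    forall v, is_derivative_at0 T (comb v) (comb (v *m G)) &
    forall v x z,
      exp_series (comb v) x z N @[N --> \oo] --> peval (comb (v *m mxexp G z)) x].
Proof.
have [r [e [y [dual Tp Te]]]] := orbit_dual_basis hT p hlf.
(* Row i holds the coordinates of T_h e_i, read off at the dual points. *)
pose A h : 'M[F]_r := \matrix_(i, j) peval (T h (e i)) (y j).
have A0 : A 0 = 1.
  by apply/matrixP => i j; rewrite !mxE (action0 hT) dual.
have AD s t : 0 <= s -> 0 <= t -> A (s + t) = A s * A t.
  move=> s0 t0; rewrite addrC; apply/matrixP => i j.
  rewrite !mxE -(actionD hT) // (Te s i s0) linear_sum peval_sum.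
  by apply: eq_bigr => l _; rewrite linearZ pevalZ !mxE.
have Acvg i j : A s i j @[s --> (0 : R)^'+] --> (1 : 'M[F]_r) i j.
  rewrite -A0 mxE; under eq_fun do rewrite mxE.
  exact: (action_right_continuous hT).
have [G AG] := semigroup_mxexp A0 AD Acvg.
exists r, e, G => comb.
have pevalc v x : peval (comb v) x = \sum_j v 0 j * peval (e j) x by rewrite peval_sum.
have Tcomb h v : 0 <= h -> T h (comb v) = comb (v *m mxexp G (of_real k h)).
  move=> h0; rewrite linear_sum -AG //.
  transitivity (\sum_i \sum_j (v 0 i * A h i j) *: e j).
    apply: eq_bigr => i _; rewrite linearZ /= Te // scaler_sumr.
    by apply: eq_bigr => j _; rewrite scalerA mxE.
  rewrite exchange_big; apply: eq_bigr => j _ /=.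
  by rewrite mxE scaler_suml.
have cvgc (I : Type) (Fl : set_system I) (FF : Filter Fl) (v : 'rV[F]_r)
    (U : I -> 'M[F]_r) (L : 'M[F]_r) x :
    (forall i j, U t i j @[t --> Fl] --> L i j) ->
    peval (comb (v *m U t)) x @[t --> Fl] --> peval (comb (v *m L)) x.
  move=> UL; rewrite pevalc; under eq_fun do rewrite pevalc.
  apply: cvg_big => [|j _]; first exact: add_continuous.
  apply: cvgMl; rewrite mxE; under eq_fun do rewrite mxE.
  apply: cvg_big => [|i _]; first exact: add_continuous.
  exact: cvgMr.
have der v : is_derivative_at0 T (comb v) (comb (v *m G)).
  move=> x; have cv := cvgc R (0 : R)^'+ (at_right_proper_filter 0) v _ G x
    (@cvg_mxexp_derivative R k r G).
  apply: cvg_trans cv; apply: near_eq_cvg; near=> h.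
  have h0 : 0 < h by near: h; exact: nbhs_right_gt.
  rewrite Tcomb ?ltW // !pevalc -sumrB mulr_suml; apply: eq_bigr => j _.
  rewrite -scalemxAr mulmxBr mulmx1 !mxE; ring.
have iterG v n : iter n (generator T) (comb v) = comb (v *m G ^+ n).
  elim: n => [|n IH]; first by rewrite expr0 mulmx1.
  by rewrite iterS IH (generatorE (der _)) exprSr -mulmxA.
split=> //.
  exists (\row_j peval p (y j)); have := Tp 0 (lexx _); rewrite (action0 hT) => {1}->.
  by apply: eq_bigr => j _; rewrite mxE.
move=> v x z; have cv := cvgc nat \oo eventually_filter v _ (mxexp G z) x
  (@cvg_expmx R k r G z).
apply: cvg_trans cv; apply: near_eq_cvg; apply: nearW => N.
rewrite /exp_series seriesEnat /= pevalc.
under [RHS]eq_bigr do rewrite iterG pevalc mulr_sumr.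
rewrite exchange_big; apply: eq_bigr => j _ /=.
rewrite mulmx_sumr summxE mulr_suml; apply: eq_bigr => n _.
by rewrite -scalemxAr mxE mulrA.
Unshelve. all: by end_near.
Qed.

(** The domain is thus the whole space, and the default value in [generator] never occurs. *)
Lemma generator_derivative p : is_derivative_at0 T p (generator T p).
Proof.
have [r [e [G [[v ->] _ der _]]]] := local_exponential p.
by rewrite (generatorE (der v)).
Qed.

Lemma generator_linear : linear (generator T).
Proof.
move=> a p q; apply: generatorE => x.
rewrite pevalD pevalZ.
pose quot f h := (peval (T h f) x - peval f x) / of_real k h.
have cv : a * quot p h + quot q h @[h --> (0 : R)^'+] -->
    a * peval (generator T p) x + peval (generator T q) x.
  by apply: cvgD; [apply: cvgMr|]; exact: generator_derivative.
apply: cvg_trans cv; apply: near_eq_cvg; apply: nearW => h.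
by rewrite /quot linearP !pevalD !pevalZ /=; ring.
Qed.

Lemma exp_series_linear a p q x z N :
  exp_series (a *: p + q) x z N = a * exp_series p x z N + exp_series q x z N.
Proof.
have iter_linear n : iter n (generator T) (a *: p + q) =
    a *: iter n (generator T) p + iter n (generator T) q.
  by elim: n => // n IH; rewrite !iterS IH generator_linear.
rewrite /exp_series !seriesEnat /= mulr_sumr -big_split.
by apply: eq_bigr => n _; rewrite iter_linear pevalD pevalZ /=; ring.
Qed.

Lemma exp_series_unique p z (q q' : V) :
  (forall x, exp_series p x z N @[N --> \oo] --> peval q x) ->
  (forall x, exp_series p x z N @[N --> \oo] --> peval q' x) -> q = q'.
Proof.
move=> hq hq'; apply: peval_inj => x.
exact: (cvg_unique (@norm_hausdorff _ _) (hq x) (hq' x)).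
Qed.

End Generator.

(** * The exponential formula and the operator group *)

Theorem proposition3p6 (R : realType) (k : scalar_kind)
    (d : measure_display) (Omega : measurableType d)
    (Pr : probability Omega R) (Filt : R -> set (set Omega))
    (hFilt : is_filtration Filt)
    (E : Type) (hE : inhabited E)
    (Pol : submodClosed (E -> (scalars R k)^o))
    (hconst : contains_constants Pol)
    (deg : polynomial Pol -> nat) (hdeg : is_degree deg)
    (T : R -> {linear polynomial Pol -> polynomial Pol})
    (hT : is_polynomial_action deg T)
    (X : Omega -> R -> E) (hX : is_polynomial_process T Pr Filt X)
    (hlf : locally_finite T) :
  (forall (p : polynomial Pol) (x : E) (h : R), 0 <= h ->
     series (fun n => of_real k h ^+ n / n`!%:R
                      * peval (iter n (generator T) p) x) N @[N --> \oo]
       --> peval (T h p) x) /\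
  exists S : scalars R k -> {linear polynomial Pol -> polynomial Pol},
    (forall (h : scalars R k) (p : polynomial Pol) (x : E),
       series (fun n => h ^+ n / n`!%:R * peval (iter n (generator T) p) x) N
         @[N --> \oo] --> peval (S h p) x) /\
    is_operator_group S.
Proof.
split=> [p x h h0|].
  have [r [e [G [[v ->] Texp _ hexp]]]] := local_exponential hT hlf p.
  by rewrite Texp //; exact: hexp.
(* Values are chosen separately for each z and p, since the local matrix changes with p; uniqueness
   of pointwise limits then forces linearity and the group law. *)
have /choice[S0 hS0] (zp : scalars R k * polynomial Pol) :
    exists q : polynomial Pol,
    forall x, exp_series T zp.2 x zp.1 N @[N --> \oo] --> peval q x.
  case: zp => z p.
  have [r [e [G [[v ->] _ _ hexp]]]] := local_exponential hT hlf p.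
  by eexists => x; exact: hexp.
have S0_unique z p q :
    (forall x, exp_series T p x z N @[N --> \oo] --> peval q x) ->
    S0 (z, p) = q.
  exact: exp_series_unique (hS0 (z, p)).
have S0_linear z : linear (fun p => S0 (z, p)).
  move=> a p q; apply: S0_unique => x.
  rewrite pevalD pevalZ; under eq_fun do rewrite (exp_series_linear hT hlf).
  apply: cvgD; last exact: (hS0 (z, q)).
  by apply: cvgMr; exact: (hS0 (z, p)).
pose S z : {linear polynomial Pol -> polynomial Pol} := HB.pack (fun p => S0 (z, p))
  (GRing.isLinear.Build _ _ _ _ (fun p => S0 (z, p)) (S0_linear z)).
exists S; split; first by move=> h p x; exact: (hS0 (h, p)).
split=> [p|h h' p]; have [r [e [G [[v ->] _ _ hexp]]]] := local_exponential hT hlf p.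
  by apply: S0_unique => x; have := hexp v x 0; rewrite mxexp0 mulmx1.
(* S h' p stays in the span attached to p, so both factors are computed with the same G; h' comes
   first because operators act on rows from the right. *)
transitivity (S h (\sum_j (v *m mxexp G h') 0 j *: e j)).
  by congr (S h _); apply: S0_unique => x; exact: hexp.
rewrite [RHS](S0_unique _ _ _ (fun x => hexp v x (h + h'))).
apply: S0_unique => x; rewrite addrC mxexpD.
by have := hexp (v *m mxexp G h') x h; rewrite -mulmxA.
Qed.
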